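(* Let $k\geq 2$ be an integer. There is a universal weighted automaton, namely the universal weighted $k$-automaton described in the context, whose states and transitions do not depend on the ring or on the equation, such that the following holds. For every commutative ring $R$, every isolating $k$-Mahler equation $P(x,y)=y-\sum_{i=1}^dA_i(x)\Phi^i(y)=0$ over $R$ and every initial condition $f_0\in R$, let $\mathcal{A}_{P,f_0}$ be the automaton obtained by instantiating the weights of the universal weighted $k$-automaton with the coefficients of $P$ and with $f_0$, and keeping only the states that occur in a path of non-zero weight. Then $\mathcal{A}_{P,f_0}$ is a weighted automaton (with finitely many states), and it generates the solution $f=\sum_{n\ge 0}f_nx^n\in R[[x]]$ of $P(x,f(x))=0$ with $f(0)=f_0$ (when such a solution exists), i.e. $\mathrm{weight}_{\mathcal{A}_{P,f_0}}((n)_k)=f_n$ for all $n\geq 0$.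
   Context: $k$-Mahler equations: $\Phi:R[[x]]\to R[[x]]$ is $\Phi(f(x))=f(x^k)$. A $k$-Mahler equation is $\sum_{i=0}^dA_i(x)\Phi^i(y)=0$ with $A_i\in R[x]$; it is isolating if $A_0=1$ (the remaining terms are then written with a minus sign as in the claim). Write $A_i(x)=\sum_{j}\alpha_{i,j}x^j$ for $1\le i\le d$ and $\alpha_{i,j}=0$ for all other indices $i\ge1$, $j\ge0$. A solution $f$ with $f(0)=f_0$ exists if and only if $f_0$ is $P$-compatible, i.e. $(\sum_i\alpha_{i,0})f_0=f_0$, and is then unique. Base $k$: $(n)_k$ is the usual base-$k$ expansion of $n$ over $\{0,\dots,k-1\}$ without leading zeros, read from the most significant digit. Weighted automaton: a tuple $(S,B,\Delta,I,F)$ with $S$ a finite set of states, $B$ an alphabet, $I,F:S\to R$ (initial and final weights) and $\Delta:S\times B\times S\to R$ (transition weights; a transition of weight $r$ is written $s\xrightarrow{b:r}s'$, and unlisted transitions have weight $0$). A path with label $b_1\cdots b_n$ visiting $s_0,\dots,s_n$ with transition weights $r_1,\dots,r_n$ has weight $I(s_0)r_1\cdots r_nF(s_n)$. $\mathrm{weight}_{\mathcal{A}}(w)$ is the sum of the weights of all paths labelled $w$. Universal weighted $k$-automaton associated to $(\alpha_{i,j})_{i\ge1,j\ge0}$ and $f_0$: it has the infinite state set $\{s_{i,j}:i,j\ge0\}$ and input alphabet $B=\{0,\dots,k-1\}$. Its transitions are $s_{i,j}\xrightarrow{b:1}s_{i+1,kj+b}$ for all $i,j\ge0$, $b\in B$,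 and $s_{i,j}\xrightarrow{b:\alpha_{i+1,kj+b-\ell}}s_{0,\ell}$ for all $i,j,\ell\ge0$, $b\in B$ with $kj+b-\ell\ge0$. The initial weights are $I(s_{i,j})=f_0$ if $j=0$ and $0$ otherwise. The final weights are $F(s_{0,0})=1$ and $F(s_{i,j})=0$ otherwise. *)

(* Defs.v *)
(* MathComp, with finmap for finite sets and finitely supported functions. *)
From HB Require Import structures.
From mathcomp Require Import all_boot all_order all_algebra.
From mathcomp Require Import finmap.

Set Implicit Arguments.
Unset Strict Implicit.
Unset Printing Implicit Defensive.

Import GRing.Theory.
Local Open Scope ring_scope.

(* R[[x]], a series being its sequence of coefficients. *)
Definition series (R : Type) : Type := nat -> R.

(* R[x], as the finitely supported series; {poly R} would exclude the zero
   ring. *)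
Definition polynomial (R : comPzRingType) : Type := {fsfun nat -> R with 0}.

Section Mahler.
Variable R : comPzRingType.

Definition polynomial_mul (a : polynomial R) (f : series R) : series R :=
  fun n => \sum_(j < n.+1) a j * f (n - j)%N.

(* f(x) |-> f(x^k) *)
Definition Phi (k : nat) (f : series R) : series R :=
  fun n => if (k %| n)%N then f (n %/ k)%N else 0.

(* The left-hand side y - \sum_(1 <= i <= d) A_i(x) Phi^i(y); only the values
   of [isolating_coef] at 1, ..., d are meaningful. *)
Record isolating_equation : Type := IsolatingEquation {
  isolating_order : nat;
  isolating_coef : nat -> polynomial R
}.

Definition isolating_lhs (k : nat) (P : isolating_equation) (y : series R) :
    series R :=
  fun n => y n - \sum_(1 <= i < (isolating_order P).+1)
                   polynomial_mul (isolating_coef P i) (iter i (Phi k) y) n.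

Definition isolating_solution (k : nat) (P : isolating_equation)
    (f : series R) : Prop :=
  forall n, isolating_lhs k P f n = 0.

Definition alpha (P : isolating_equation) (i j : nat) : R :=
  if (1 <= i <= isolating_order P)%N then isolating_coef P i j else 0.

End Mahler.

(* The state type S is not required to be finite and the weights W need not
   form a ring, so that this covers the universal automaton; a weighted
   automaton over a ring R is the case S : finType, W = R. *)
Record automaton (S B W : Type) : Type := Automaton {
  initial : S -> W;
  transition : S -> B -> S -> W;
  final : S -> W
}.

Section Weight.
Variables (R : comPzRingType) (B : Type).

(* The weight of the path labelled w_0 ... w_(n-1) visiting p_0, ..., p_n. *)
Definition path_weight (S : Type) (A : automaton S B R) (n : nat)
    (w : n.-tuple B) (p : n.+1.-tuple S) : R :=
  initial A (tnth p ord0)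
  * (\prod_(t < n) transition A (tnth p (widen_ord (leqnSn n) t)) (tnth w t)
                     (tnth p (lift ord0 t)))
  * final A (tnth p ord_max).

Definition weight (S : finType) (A : automaton S B R) (w : seq B) : R :=
  \sum_(p : (size w).+1.-tuple S) path_weight A (in_tuple w) p.

Definition occurs_in_nonzero_path (S : eqType) (A : automaton S B R) (s : S) :
    Prop :=
  exists (n : nat) (w : n.-tuple B) (p : n.+1.-tuple S),
    path_weight A w p <> 0 /\ s \in p.

End Weight.

Definition restrict (S : choiceType) (B W : Type) (A : automaton S B W)
    (Q : {fset S}) : automaton Q B W :=
  {| initial := fun s => initial A (val s);
     transition := fun s b s' => transition A (val s) b (val s');
     final := fun s => final A (val s) |}.

Inductive symbol : Type :=
| SymZero
| SymOne
| SymAlpha of nat & nat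
| SymInit.

(* The pair (i, j) is the state s_{i,j}. The two families of transitions have
   disjoint targets, in rows i + 1 and 0. *)
Definition universal_automaton (k : nat) : automaton (nat * nat) 'I_k symbol :=
  {| initial := fun s : nat * nat => if s.2 == 0%N then SymInit else SymZero;
     transition := fun (s : nat * nat) (b : 'I_k) (s' : nat * nat) =>
       let m := (k * s.2 + b)%N in
       if s' == (s.1.+1, m) then SymOne
       else if (s'.1 == 0%N) && (s'.2 <= m)%N then SymAlpha s.1.+1 (m - s'.2)
       else SymZero;
     final := fun s : nat * nat => if s == (0%N, 0%N) then SymOne else SymZero |}.

Definition symbol_value (R : comPzRingType) (a : nat -> nat -> R) (f0 : R)
    (c : symbol) : R :=
  match c with
  | SymZero => 0
  | SymOne => 1
  | SymAlpha i j => a i j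
  | SymInit => f0
  end.

Definition instantiate (R : comPzRingType) (S B : Type)
    (A : automaton S B symbol) (a : nat -> nat -> R) (f0 : R) :
    automaton S B R :=
  {| initial := fun s => symbol_value a f0 (initial A s);
     transition := fun s b s' => symbol_value a f0 (transition A s b s');
     final := fun s => symbol_value a f0 (final A s) |}.

Section Digits.
Variables (k : nat) (k_gt1 : (1 < k)%N).

Definition last_digit (n : nat) : 'I_k := Ordinal (ltn_pmod n (ltnW k_gt1)).

Fixpoint digits_rec (fuel n : nat) : seq 'I_k :=
  if fuel is fuel'.+1 then
    if n == 0%N then [::]
    else rcons (digits_rec fuel' (n %/ k)) (last_digit n)
  else [::].

(* (n)_k, most significant digit first; (0)_k is the empty word. As k > 1,
   n steps suffice. *)
Definition digits (n : nat) : seq 'I_k := digits_rec n n.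

End Digits.

(* Main.v *)
Require Import Defs.
From HB Require Import structures.
From mathcomp Require Import all_boot all_order all_algebra.
From mathcomp Require Import finmap zify boolp.

(* Let f be the solution. After reading (n)_k, the total weight of the paths
   ending in s_{i,j} is the coefficient of x^(n-j) in Phi^i(f): this holds for
   the empty word because every Phi^i(f) has constant term f_0; reading a digit
   preserves it along s_{i,j} -> s_{i+1,kj+b} by the definition of Phi, and
   along the transitions into row 0 by the Mahler equation. The state s_{0,0}
   thus carries the coefficient f_n. As for finiteness, if the A_i have degree
   at most D, then no transition of non-zero weight enters the box i <= d,
   j <= D from outside (this uses k >= 2), so paths of non-zero weight, which
   end in s_{0,0}, stay in the box. *)

Set Implicit Arguments.
Unset Strict Implicit.
Unset Printing Implicit Defensive.

Import GRing.Theory.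
Local Open Scope fset_scope.
Local Open Scope ring_scope.

(** * Path sums as matrix products, and restriction to finite sets of states *)

Section Weight.
Variables (R : comPzRingType) (B : Type).

Definition read (S : finType) (step : S -> B -> S -> R) (v : S -> R) (b : B) :
    S -> R :=
  fun s' => \sum_s v s * step s b s'.

(** Distributivity factors the sum over paths: the row vector of initial weights is multiplied by
    one transition matrix per letter. *)
Lemma weight_foldl (S : finType) (A : automaton S B R) (w : seq B) :
  weight A w = \sum_s foldl (read (transition A)) (initial A) w s * final A s.
Proof.
case: A => v tr fin /=; elim: w v => [|b w IHw] v.
  rewrite /weight /= (reindex (fun s : S => [tuple s])) /=; last first.
    exists (fun p => thead p) => [//|p _].
    by case/tupleP: p => s p; rewrite (tuple0 p); apply: val_inj.
  apply: eq_bigr => s _; rewrite /path_weight /= big_ord0 mulr1.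
  by rewrite !(tnth_nth s).
set A := Automaton v tr fin.
(* The first letter is absorbed into the initial weights; a path then splits into its first state
   [s] and the remaining path [p]. *)
rewrite -[RHS](IHw (read tr v b)) /weight /=.
pose cons_tuple s (p : (size w).+1.-tuple S) := [tuple of s :: p].
rewrite (reindex (fun q => cons_tuple q.1 q.2)) /=; last first.
  exists (fun p => (thead p, [tuple of behead p])) => [[s p] _|p _].
    by congr pair; apply: val_inj.
  by case/tupleP: p => s p; apply: val_inj.
rewrite -(pair_bigA _ (fun s p =>
  path_weight A (in_tuple (b :: w)) (cons_tuple s p))) /=.
rewrite exchange_big /=; apply: eq_bigr => p _.
rewrite /path_weight /= /read !mulr_suml; apply: eq_bigr => s _.
rewrite big_ord_recl /= !mulrA; congr (_ * _ * _ * _) => //.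
- by congr tr; rewrite !(tnth_nth s).
- apply: eq_bigr => t _.
  by congr tr; rewrite ?(tnth_nth s) ?(tnth_nth b).
- by rewrite !(tnth_nth s).
Qed.

(** A path in [Q'] that leaves [Q] has weight zero. Weights can thus be computed on a convenient
    larger set instead of the exact set of occurring states. *)
Lemma eq_weight_restrict (S : choiceType) (A : automaton S B R)
    (Q Q' : {fset S}) (w : seq B) :
    Q `<=` Q' ->
    (forall s, s \in Q' -> occurs_in_nonzero_path A s -> s \in Q) ->
  weight (restrict A Q) w = weight (restrict A Q') w.
Proof.
move=> sQQ' occQ; pose h := map_tuple (T := Q) (n := (size w).+1) (fincl sQQ').
have val_h (p : (size w).+1.-tuple Q) :
  map_tuple val (h p) = map_tuple val p.
  by apply: val_inj; rewrite /= -map_comp; apply: eq_map => s.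
have path_weightE (Q0 : {fset S}) (p : (size w).+1.-tuple Q0) :
  path_weight (restrict A Q0) (in_tuple w) p
  = path_weight A (in_tuple w) (map_tuple val p).
  rewrite /path_weight !tnth_map /=; congr (_ * _ * _).
  by apply: eq_bigr => t _; rewrite !tnth_map.
have h_inj : injective h.
  move=> p p' /(congr1 val) /= eq_h; apply: val_inj; apply: inj_map eq_h.
  by move=> s s' /(congr1 val) /= /val_inj.
rewrite /weight [RHS](bigID (fun p => p \in [set h p | p : _.-tuple _])) /=.
rewrite [X in _ = _ + X]big1 => [|p pNh]; last first.
  apply/eqP; apply: contraNT pNh => /eqP; rewrite path_weightE => p_neq0.
  have pQ i : val (tnth p i) \in Q.
    apply: occQ; first exact: valP.
    exists (size w), (in_tuple w), (map_tuple val p).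
    by split=> //; apply/map_f/mem_tnth.
  apply/imsetP; exists [tuple [` pQ i] | i < _] => //.
  by apply: eq_from_tnth => i; rewrite tnth_map tnth_mktuple; apply: val_inj.
rewrite addr0 big_imset /=; last by move=> p p' _ _ /h_inj.
by apply: eq_big => [p|p _]; rewrite ?inE // !path_weightE val_h.
Qed.

End Weight.

(** * Reindexing finite sums *)

Lemma eq_sum_ord (V : nmodType) (F : nat -> V) (N M : nat) :
    (forall j, (N <= j)%N || (M <= j)%N -> F j = 0) ->
  \sum_(j < N) F j = \sum_(j < M) F j.
Proof.
wlog leNM : N M / (N <= M)%N => [IH|] F0.
  have [|/ltnW] := leqP N M => [/IH|/IH eqMN]; first exact.
  by rewrite -eqMN // => j; rewrite orbC; apply: F0.
rewrite (big_ord_widen _ _ leNM) big_mkcond; apply: eq_bigr => j _.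
by case: ltnP => // le_Nj; rewrite F0 ?le_Nj.
Qed.

Lemma sum_multiples (V : nmodType) (k N M : nat) (F : nat -> V) :
    (0 < k)%N -> (N %/ k <= M)%N ->
  \sum_(u < N.+1 | (k %| u)%N) F u
  = \sum_(v < M.+1 | (k * v <= N)%N) F (k * v)%N.
Proof.
move=> k_gt0 leNM.
rewrite (reindex_onto (fun v : 'I_M.+1 => inord (k * v) : 'I_N.+1)
                      (fun u => inord (u %/ k))); last first.
  move=> u /dvdnP[v uv]; have lt_v : (v < M.+1)%N.
    rewrite ltnS (leq_trans _ leNM) // -(mulnK v k_gt0) -uv.
    by rewrite leq_div2r // -ltnS.
  by rewrite uv mulnK // (inordK lt_v) mulnC -uv inord_val.
have inord_le v :
    (k * v <= N)%N -> (inord (k * v) : 'I_N.+1) = (k * v)%N :> nat.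
  by move=> le_N; rewrite inordK.
have condE (v : 'I_M.+1) :
    (k %| (inord (k * v) : 'I_N.+1))%N
      && (inord ((inord (k * v) : 'I_N.+1) %/ k) == v) = (k * v <= N)%N.
  have [le_N|lt_N] := leqP (k * v) N.
    by rewrite inord_le // dvdn_mulr // mulKn // inord_val eqxx.
  (* Out of range, [inord] defaults to 0; the round trip then gives 0, which is not [v] because
     [k * v > N]. *)
  have -> : inord (k * v) = ord0 :> 'I_N.+1.
    by rewrite /inord /insubd insubN // -leqNgt.
  rewrite dvdn0 div0n; apply: contraTF lt_N => /eqP <-.
  by rewrite inordK // muln0.
by apply: eq_big => [v|v]; rewrite condE // => /inord_le ->.
Qed.

(** * The finite box of states *)

Definition box (d D : nat) : {fset nat * nat} :=
  [fset i in iota 0 d.+1] `*` [fset j in iota 0 D.+1].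

Lemma in_box (d D : nat) (s : nat * nat) :
  (s \in box d D) = (s.1 <= d)%N && (s.2 <= D)%N.
Proof. by case: s => i j; rewrite in_fsetM !inE !mem_iota /=; lia. Qed.

Lemma sum_box (V : nmodType) (d D : nat) (F : nat * nat -> V) :
  \sum_(s : box d D) F (val s)
  = \sum_(i < d.+1) \sum_(j < D.+1) F (i : nat, j : nat).
Proof.
have in_b (p : 'I_d.+1 * 'I_D.+1) : (p.1 : nat, p.2 : nat) \in box d D.
  by rewrite in_box !leq_ord.
rewrite (pair_bigA _ (fun i j : 'I__ => F (i : nat, j : nat))).
rewrite (reindex (fun p => [` in_b p])) //=.
exists (fun s => (inord (val s).1, inord (val s).2)) => [[i j]|s] _ /=.
  by rewrite !inord_val.
have := valP s; rewrite in_box => /andP[le_d le_D].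
by apply: val_inj; rewrite /= !inordK //; case: (val s).
Qed.

Section Universal.
Variables (k : nat) (k_gt1 : (1 < k)%N) (R : comPzRingType).
Variables (P : isolating_equation R) (f0 : R).
Let d := isolating_order P.
Let A := instantiate (universal_automaton k) (alpha P) f0.

Lemma alpha_row_out i j : (d < i)%N -> alpha P i j = 0.
Proof. by move=> lt_di; rewrite /alpha ifF //; rewrite -/d; lia. Qed.

Lemma alpha_bounded : exists D, forall i j, (D < j)%N -> alpha P i j = 0.
Proof.
pose deg i := \max_(j <- finsupp (isolating_coef P i)) j.
exists (\max_(i < d.+1) deg i) => i j ltDj.
rewrite /alpha; case: ifP => // /andP[_ le_id].
apply: fsfun_dflt; apply: contraL ltDj => jP; rewrite -leqNgt.
apply: leq_trans (leq_bigmax (Ordinal (le_id : i < d.+1)%N)).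
exact: (leq_bigmax_seq (F := id)).
Qed.

Variable D : nat.
Hypothesis alpha_out : forall i j, (D < j)%N -> alpha P i j = 0.

(** For a transition from (i, j) to (0, l), a non-zero coefficient forces i + 1 <= d and k * j + b -
    l <= D; with l <= D this gives 2 * j <= 2 * D. *)
Lemma box_backward s b s' :
  transition A s b s' != 0 -> s' \in box d D -> s \in box d D.
Proof.
rewrite !in_box /A /=; case: (s' =P _) => [-> _ /=|_]; first by nia.
case: ifP => [/andP[_ le_s'] /=|_]; last by rewrite eqxx.
have [le_d|lt_d] := leqP s.1.+1 d; last by rewrite alpha_row_out ?eqxx.
have [le_D|lt_D] := leqP (k * s.2 + b - s'.2) D; last first.
  by rewrite alpha_out ?eqxx.
by nia.
Qed.

Lemma occurs_in_box s : occurs_in_nonzero_path A s -> s \in box d D.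
Proof.
move=> [n [w [p [/eqP + /tnthP[t ->]]]]] {s}.
rewrite /path_weight => p_neq0.
have final_neq0 : final A (tnth p ord_max) != 0.
  by apply: contraNneq p_neq0 => ->; rewrite mulr0.
have step_neq0 (i : 'I_n) :
    transition A (tnth p (widen_ord (leqnSn n) i)) (tnth w i)
      (tnth p (lift ord0 i)) != 0.
  apply: contraNneq p_neq0; rewrite (bigD1 i) //= => ->.
  by rewrite mul0r mulr0 mul0r.
(* Induction on the distance to the end of the path, whose last state is (0, 0) because its final
   weight is non-zero. *)
suff box_from_end m (i : 'I_n.+1) : (n - i)%N = m -> tnth p i \in box d D.
  exact: (box_from_end (n - t)%N).
elim: m i => [|m IHm] i ni.
  have -> : i = ord_max by apply: val_inj => /=; have := ltn_ord i; lia.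
  move: final_neq0; rewrite in_box /A /=; case: (tnth p _ =P _) => [->|] //=.
  by rewrite eqxx.
have lt_in : (i < n)%N by lia.
have /box_backward := step_neq0 (Ordinal lt_in).
have -> : widen_ord (leqnSn n) (Ordinal lt_in) = i by apply: val_inj.
by apply; apply: IHm; rewrite /= /bump /=; lia.
Qed.

(** * The invariant carried by the states *)

Variable f : series R.
Hypotheses (f_sol : isolating_solution k P f) (f_init : f 0%N = f0).

(* The coefficient of x^(n-j) in Phi^i(f), for s = (i, j). *)
Definition forward (n : nat) (s : nat * nat) : R :=
  if (s.2 <= n)%N then iter s.1 (Phi k) f (n - s.2)%N else 0.

Lemma forward0 s : forward 0 s = initial A s.
Proof.
case: s => i [|j]; rewrite /forward //= subnn.
elim: i => [|i IHi] /=; first exact: f_init.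
by rewrite /Phi dvdn0 div0n.
Qed.

(** Row i contributes to s_{0,l} the coefficient of x^(kn+b-l) in A_{i+1} Phi^{i+1}(f), since
    Phi^{i+1}(f) has only exponents divisible by k. *)
Lemma forward_row (n i l : nat) (b : 'I_k) : (l <= D)%N ->
  \sum_(j < D.+1) forward n (i, j : nat) *
    (if (l <= k * j + b)%N then alpha P i.+1 (k * j + b - l)%N else 0)
  = if (l <= k * n + b)%N then
      \sum_(t < (k * n + b - l).+1)
        alpha P i.+1 t * iter i.+1 (Phi k) f (k * n + b - l - t)%N
    else 0.
Proof.
move=> le_lD; rewrite (@eq_sum_ord _ (fun j => forward n (i, j) *
    (if (l <= k * j + b)%N then alpha P i.+1 (k * j + b - l)%N else 0)) _ n.+1).
  (* Put v = n - j on the left and u = kn + b - l - t on the right: only u = kv survives, and the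
     sums match term by term. *)
  rewrite (reindex_inj rev_ord_inj) /=.
  under eq_bigr => v _ do
    rewrite subSS {1}/forward /= leq_subr (subKn (leq_ord v)).
  case: ifP => le_l; last first.
    rewrite big1 // => v _; rewrite ifF ?mulr0 //.
    apply: contraFF le_l => /leq_trans; apply.
    by rewrite leq_add2r leq_mul2l leq_subr orbT.
  rewrite [RHS](reindex_inj rev_ord_inj) /=.
  under [RHS]eq_bigr => u _ do rewrite subSS (subKn (leq_ord u)) {1}/Phi.
  under [RHS]eq_bigr => u _ do rewrite (fun_if (fun x => _ * x)) mulr0.
  rewrite -big_mkcond /= (@sum_multiples _ k _ n (fun u =>
    alpha P i.+1 (k * n + b - l - u)%N *
      iter i (Phi k) f (u %/ k)%N)); last first.
  - by rewrite -ltnS ltn_divLR ?(ltnW k_gt1) //; have := ltn_ord b; nia.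
  - exact: ltnW.
  rewrite [RHS]big_mkcond /=; apply: eq_bigr => v _.
  have le_vn := leq_ord v.
  rewrite mulKn ?(ltnW k_gt1) // mulnBr.
  have le_kvn : (k * v <= k * n)%N by rewrite leq_mul2l le_vn orbT.
  have -> : (l <= k * n - k * v + b)%N = (k * v <= k * n + b - l)%N by lia.
  case: ifP => [le_kv|_]; last by rewrite mulr0.
  by rewrite mulrC; congr (alpha _ _ _ * _); lia.
(* If j > D, then kj + b - l >= 2j - D > D and the coefficient vanishes; if j > n, [forward]
   vanishes. *)
move=> j /orP[] lt_j.
  case: ifP => _; rewrite ?mulr0 // alpha_out ?mulr0 //; nia.
by rewrite /forward /= leqNgt lt_j mul0r.
Qed.

Lemma forward_step n (b : 'I_k) s' : s' \in box d D ->
  \sum_(s : box d D) forward n (val s) * transition A (val s) b s'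
  = forward (k * n + b) s'.
Proof.
rewrite in_box; case: s' => [[|i] m] /andP[/= le_d le_D].
  rewrite (sum_box d D (fun s =>
    forward n s * transition A s b (0%N, m))) /=.
  under eq_bigr => i _.
    under eq_bigr => j _ do rewrite (fun_if (symbol_value _ _)) /=.
    rewrite forward_row //; over.
  rewrite /forward /=; case: ifP => _; last by rewrite big1.
  (* Row i carries the coefficients of A_{i+1}, so the last row d contributes nothing and the others
     give exactly A_1, ..., A_d. *)
  rewrite big_ord_recr /= [X in _ + X]big1 => [|t _]; last first.
    by rewrite alpha_row_out ?mul0r.
  have /eqP := f_sol (k * n + b - m)%N; rewrite subr_eq0 => /eqP ->.
  rewrite addr0 big_add1 big_mkord; apply: eq_bigr => i _.
  by apply: eq_bigr => t _; rewrite /alpha ifT //= ltn_ord.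
(* If m and b differ modulo k, then (i + 1, m) has no predecessor under b, and kn + b - m is not a
   multiple of k. Otherwise the only predecessor is (i, m %/ k). *)
have [eq_b|neq_b] := eqVneq (m %% k)%N (b : nat); last first.
  rewrite big1 => [|[[i' j] /= _] _].
    rewrite /forward /=; case: ifP => // le_m; rewrite /Phi ifF //.
    apply: contraNF neq_b => dvd; rewrite -(modn_small (ltn_ord b)).
    by rewrite -(modnMDl n b k) mulnC eq_sym eqn_mod_dvd.
  case: eqP => [[_ eq_m]|_]; last by rewrite mulr0.
  by case/eqP: neq_b; rewrite eq_m mulnC modnMDl modn_small.
have box_pred : (i, m %/ k)%N \in box d D.
  by rewrite in_box /= (ltnW le_d) (leq_trans (leq_div _ _)).
rewrite (bigD1 [` box_pred]) //= big1 ?addr0 => [|[[i' j] /= box_s] neq_s].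
  rewrite {1}mulnC -eq_b -divn_eq eqxx mulr1 /forward /=.
  have {1}-> : (m <= k * n + m %% k)%N = (m %/ k <= n)%N.
    by rewrite {1}(divn_eq m k) leq_add2r mulnC leq_pmul2l // ltnW.
  case: leqP => // le_n.
  have -> : (k * n + m %% k - m = k * (n - m %/ k))%N.
    rewrite [in X in (_ - X)%N](divn_eq m k) subnDr.
    by rewrite [(_ %/ _ * _)%N]mulnC -mulnBr.
  by rewrite /Phi dvdn_mulr // mulKn // ltnW.
case: eqP => [[eq_i eq_m]|_]; last by rewrite mulr0.
case/eqP: neq_s; apply: val_inj => /=; rewrite eq_i eq_m.
by rewrite mulnC divnMDl ?(ltnW k_gt1) // divn_small // addn0.
Qed.

Lemma foldl_digits_rec (fuel n : nat) (s : box d D) : (n <= fuel)%N ->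
  foldl (read (transition (restrict A (box d D))))
    (initial (restrict A (box d D)))
    (digits_rec k_gt1 fuel n) s = forward n (val s).
Proof.
elim: fuel n s => [|fuel IHn] n s /=.
  by rewrite leqn0 => /eqP->; rewrite forward0.
case: eqP => [-> _|/eqP n_neq0 le_n]; first by rewrite /= forward0.
rewrite foldl_rcons {1}/read.
under eq_bigr => t _.
  rewrite IHn; last first.
    by rewrite -ltnS (leq_trans _ le_n) // ltn_Pdiv // lt0n.
  over.
by rewrite (forward_step _ _ (valP s)) /= mulnC -divn_eq.
Qed.

End Universal.

Theorem theorem2 (k : nat) (k_gt1 : (1 < k)%N) (R : comPzRingType)
    (P : isolating_equation R) (f0 : R) :
  let A := instantiate (universal_automaton k) (alpha P) f0 in
  exists Q : {fset nat * nat},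
    (forall s : nat * nat, s \in Q <-> occurs_in_nonzero_path A s) /\
    (forall f : series R, isolating_solution k P f -> f 0%N = f0 ->
       forall n : nat, weight (restrict A Q) (digits k_gt1 n) = f n).
Proof.
move=> A; have [D alpha_out] := alpha_bounded P.
set bx := box (isolating_order P) D.
(* Occurrence in a path of non-zero weight is made boolean classically; the box makes the set
   finite. *)
pose Q := [fset s in bx | `[< occurs_in_nonzero_path A s >]].
have occQ s : (s \in Q) = `[< occurs_in_nonzero_path A s >].
  rewrite in_fset unfold_in /= andb_idl // => /asboolP; exact: occurs_in_box.
exists Q; split=> [s|f f_sol f_init n].
  by rewrite occQ; split=> /asboolP.
(* The weight is computed on the whole box, where the invariant [forward] holds at every state. *)
rewrite (@eq_weight_restrict _ _ _ _ _ bx); last first.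
- by move=> s _ occ_s; rewrite occQ; apply/asboolP.
- by apply/fsubsetP => s; rewrite occQ => /asboolP; exact: occurs_in_box.
rewrite weight_foldl.
have box00 : (0%N, 0%N) \in bx by rewrite in_box.
rewrite (bigD1 [` box00]) //= big1 ?addr0 => [|s s_neq0].
  rewrite (foldl_digits_rec k_gt1 alpha_out f_sol f_init) //.
  by rewrite /forward /= subn0 mulr1.
case: eqP => [s00|]; last by rewrite mulr0.
by case/eqP: s_neq0; apply: val_inj.
Qed.
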